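(* Let $\mathcal{V}$ be a variety with $\vec 0$ \& $\vec 1$ having the Determining Property, let $A\in\mathcal{V}$, let $\theta,\theta^*$ be complementary factor congruences of $A$, and let $\vec e\in A^l$ satisfy $\vec 0\,\theta\,\vec e\,\theta^*\,\vec 1$. Then for all $c,d\in A$: $(c,d)\in\theta$ if and only if $A\models\Phi_1(c,d,\vec e)\wedge\Phi_2(c,d,\vec e)$, where $$\Phi_1(x,y,\vec z):=\exists y_1\forall x_1\cdots\exists y_n\forall x_n\ \bigwedge_{m=1}^{k}\Psi_{2m},\qquad \Phi_2(x,y,\vec z):=\exists x_1\forall y_1\cdots\exists x_n\forall y_n\ \bigwedge_{m=1}^{k}\Psi_{2m-1},$$ with $k,n$ and the formulas $\Psi_m$ as described in the context.
   Context: A variety with $\vec 0$ \& $\vec 1$ is a variety $\mathcal{V}$ with terms $\vec 0=(0_1,\dots,0_l)$, $\vec 1=(1_1,\dots,1_l)$, assumed closed (variable-free), such that $\mathcal{V}\models\vec 0=\vec 1\to x=y$. Congruences $\theta,\theta^*$ of $A$ are complementary factor congruences if $\theta\cap\theta^*=\Delta$ and $\theta\circ\theta^*=\nabla$. For tuples, $\vec a\,\theta\,\vec b$ means $(a_i,b_i)\in\theta$ for all $i$. $\vec e\in A^l$ is a central element if there is an isomorphism $A\to A_1\times A_2$ with $\vec e\mapsto((0_1,1_1),\dots,(0_l,1_l))$. Determining Property: for every $A\in\mathcal{V}$, the map $(\theta,\theta^* )\mapsto$ the unique $\vec e\in A^l$ with $\vec 0\,\theta\,\vec e\,\theta^*\,\vec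 1$ is a bijection between pairs of complementary factor congruences of $A$ and central elements of $A$. Fixed terms. Because $\mathcal{V}$ has the Determining Property, there exist (and we fix) positive integers $k,n$, $N:=2k$, terms $s_i,t_i$ of arity $2i+l$ ($1\le i\le n$), and for every word $\alpha$ over $\{1,\dots,N\}$ of length $|\alpha|\le N$ terms $L_\alpha,R_\alpha$ in the variables $\vec X=(x,y,\vec z,x_1,y_1,\dots,x_n,y_n)$, $\vec z=(z_1,\dots,z_l)$, such that the identities listed below hold in $\mathcal{V}$. Here $\sigma(\vec X),\sigma^*(\vec X),\rho(\vec X),\rho^*(\vec X)$ are the tuples of terms $(x',y',\vec z\,',x_1',y_1',\dots,x_n',y_n')$ defined recursively ($j=1,\dots,n$) by: - $\sigma$: $x'=x$, $y'=x$, $\vec z\,'=\vec 0$, $x_j'=s_j(x',y',\vec z\,',x_1',y_1',\dots,x_{j-1}',y_{j-1}')$, $y_j'=y_j$; - $\sigma^*$: $x'=x$, $y'=y$, $\vec z\,'=\vec 1$, $x_j'=t_j(x',y',\vec z\,',x_1',y_1',\dots,x_{j-1}',y_{j-1}')$, $y_j'=y_j$; - $\rho$: $x'=x$, $y'=y$, $\vec z\,'=\vec 0$, $x_j'=x_j$, $y_j'=s_j(x',y',\vec z\,',x_1',y_1',\dots,x_{j-1}',y_{j-1}')$; - $\rho^*$: $x'=x$, $y'=y$, $\vec z\,'=\vec 1$, $x_j'=x_j$, $y_j'=t_j(x',y',\vec z\,',x_1',y_1',\dots,x_{j-1}',y_{j-1}')$. Identities ($\varepsilon$ = empty word, $\alpha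 j$ = concatenation; write $\rho$ for $\rho(\vec X)$, etc.): - $|\alpha|=N$: $L_\alpha(\rho)\approx R_\alpha(\rho)$ and $L_\alpha(\rho^* )\approx R_\alpha(\rho^* )$. - $\alpha=\varepsilon$: $L_\varepsilon(\vec X)\approx x$, $R_\varepsilon(\vec X)\approx y$, $L_\varepsilon(\rho)\approx L_1(\rho)$, $R_j(\rho)\approx L_{j+1}(\rho)$ for $1\le j\le N-1$, $R_N(\rho)\approx R_\varepsilon(\rho)$. - $0<|\alpha|<N$, $|\alpha|$ even: $L_\alpha(\rho)\approx L_{\alpha1}(\rho)$, $R_{\alpha j}(\rho)\approx L_{\alpha(j+1)}(\rho)$ for $1\le j\le k-1$, $R_{\alpha k}(\rho)\approx R_\alpha(\rho)$; $L_\alpha(\rho^* )\approx L_{\alpha(k+1)}(\rho^* )$, $R_{\alpha j}(\rho^* )\approx L_{\alpha(j+1)}(\rho^* )$ for $k+1\le j\le N-1$, $R_{\alpha N}(\rho^* )\approx R_\alpha(\rho^* )$. - $0<|\alpha|<N$, $|\alpha|$ odd: $L_\alpha(\sigma)\approx L_{\alpha1}(\sigma)$, $R_{\alpha j}(\sigma)\approx L_{\alpha(j+1)}(\sigma)$ for $1\le j\le k-1$, $R_{\alpha k}(\sigma)\approx R_\alpha(\sigma)$; $L_\alpha(\sigma^* )\approx L_{\alpha(k+1)}(\sigma^* )$, $R_{\alpha j}(\sigma^* )\approx L_{\alpha(j+1)}(\sigma^* )$ for $k+1\le j\le N-1$, $R_{\alpha N}(\sigma^* )\approx R_\alpha(\sigma^*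 )$. For $1\le m\le N$ define the formula $$\Psi_m:=\bigwedge_{|\alpha|=m}\Bigl(\bigl(\bigwedge_{\gamma\neq\varepsilon}L_{\alpha\gamma}(\vec X)=R_{\alpha\gamma}(\vec X)\bigr)\to L_\alpha(\vec X)=R_\alpha(\vec X)\Bigr),$$ where the inner conjunction is over all words $\gamma\ne\varepsilon$ with $|\alpha\gamma|\le N$ (so for $m=N$ the antecedent is empty, i.e. true). *)

(* Defs.v *)
From HB Require Import structures.
From mathcomp Require Import all_boot.
From mathcomp Require Import all_classical.

Set Implicit Arguments.
Unset Strict Implicit.
Unset Printing Implicit Defensive.

Local Open Scope classical_set_scope.

Record signature := Signature { symbol : Type; arity : symbol -> nat }.

Inductive term (S : signature) (X : Type) :=
| Var of X
| App (f : symbol S) of ('I_(arity f) -> term S X).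
Arguments Var {S X} _.
Arguments App {S X} f _.

Record algebra (S : signature) := Algebra {
  carrier :> Type;
  interp : forall f : symbol S, ('I_(arity f) -> carrier) -> carrier;
  carrier_inhabited : inhabited carrier }.
Arguments interp {S} a f _.

Fixpoint eval S (A : algebra S) X (v : X -> A) (t : term S X) : A :=
  match t with
  | Var x => v x
  | App f u => interp A f (fun i => eval v (u i))
  end.

Fixpoint subst S X Y (v : X -> term S Y) (t : term S X) : term S Y :=
  match t with
  | Var x => v x
  | App f u => App f (fun i => subst v (u i))
  end.

(* Closed terms have type [term S void]. *)
Definition closed_val S (A : algebra S) (t : term S void) : A :=
  eval (of_void A) t.

Definition closed_lift S Y (t : term S void) : term S Y :=
  subst (of_void (term S Y)) t.

Definition satisfies S (A : algebra S) X (s t : term S X) :=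
  forall v : X -> A, eval v s = eval v t.

Definition valid S (V : set (algebra S)) X (s t : term S X) :=
  forall A, V A -> satisfies A s t.

(* Varieties are equational classes; identities are taken over a countable
   set of variables. *)
Definition variety S (V : set (algebra S)) :=
  exists E : set (term S nat * term S nat),
    V = [set A | forall p, E p -> satisfies A p.1 p.2].

Definition variety01 S (V : set (algebra S)) l
    (zero one : 'I_l -> term S void) :=
  variety V /\
  forall A, V A -> (forall i, closed_val A (zero i) = closed_val A (one i)) ->
  forall x y : A, x = y.

Definition congruence S (A : algebra S) (th : set (A * A)) :=
  [/\ forall x, th (x, x),
      forall x y, th (x, y) -> th (y, x),
      forall x y z, th (x, y) -> th (y, z) -> th (x, z) &
      forall f (u v : 'I_(arity f) -> A),
        (forall i, th (u i, v i)) -> th (interp A f u, interp A f v)].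

(* [B \; A] relates x to y when A (x, z) and B (z, y) for some z. *)
Definition complementary S (A : algebra S) (th ths : set (A * A)) :=
  [/\ congruence th, congruence ths,
      th `&` ths = diagonal & (ths \; th)%relation = setT].

(* 0 th e ths 1, componentwise *)
Definition separates S (A : algebra S) l (zero one : 'I_l -> term S void)
    (th ths : set (A * A)) (e : 'I_l -> A) :=
  forall i, th (closed_val A (zero i), e i) /\ ths (e i, closed_val A (one i)).

Definition prod_inhabited S (A B : algebra S) : inhabited (A * B) :=
  match carrier_inhabited A, carrier_inhabited B with
  | inhabits a, inhabits b => inhabits (a, b)
  end.

Definition prod_algebra S (A B : algebra S) : algebra S :=
  @Algebra S (A * B)%type
    (fun f u => (interp A f (fun i => (u i).1), interp B f (fun i => (u i).2)))
    (prod_inhabited A B).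

Definition isomorphism S (A B : algebra S) (h : A -> B) :=
  bijective h /\
  forall f (u : 'I_(arity f) -> A),
    h (interp A f u) = interp B f (fun i => h (u i)).

Definition central S (A : algebra S) l (zero one : 'I_l -> term S void)
    (e : 'I_l -> A) :=
  exists (A1 A2 : algebra S) (h : A -> prod_algebra A1 A2),
    isomorphism h /\
    forall i, h (e i) = (closed_val A1 (zero i), closed_val A2 (one i)).

Definition determining_property S (V : set (algebra S)) l
    (zero one : 'I_l -> term S void) :=
  forall A, V A ->
  exists phi : set (A * A) * set (A * A) -> ('I_l -> A),
    (forall th ths, complementary th ths ->
       forall e, separates zero one th ths e <-> e = phi (th, ths)) /\
    set_bij [set p | complementary p.1 p.2] [set e | central zero one e] phi.

(* The variables x, y, z_1..z_l, x_1..x_n, y_1..y_n.  Indices are 0-based: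
   [vX j] stands for x_(j+1), and similarly for [vY] and [vZ]. *)
Inductive var (l n : nat) :=
| vx | vy | vZ of 'I_l | vX of 'I_n | vY of 'I_n.
Arguments vx {l n}.
Arguments vy {l n}.
Arguments vZ {l n} _.
Arguments vX {l n} _.
Arguments vY {l n} _.

HB.instance Definition _ l n := gen_eqMixin (var l n).

(* The variables preceding x_(j+1) and y_(j+1), as variables of the full
   tuple. *)
Definition initial l n (j : 'I_n) (v : var l j) : var l n :=
  let w := widen_ord (ltnW (ltn_ord j)) in
  match v with
  | vx => vx
  | vy => vy
  | vZ i => vZ i
  | vX i => vX (w i)
  | vY i => vY (w i)
  end.

(* Tuple with first entries x', y', z', the remaining ones unchanged. *)
Definition start S l n (x' y' : term S (var l n)) (z' : 'I_l -> term S void)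
    (v : var l n) : term S (var l n) :=
  match v with
  | vx => x'
  | vy => y'
  | vZ i => closed_lift (var l n) (z' i)
  | vX j => Var (vX j)
  | vY j => Var (vY j)
  end.

(* For j = 0, .., n-1 in this order, replaces the entry at [c j] by [r j]
   applied to the current entries at the preceding variables, which are then
   final. *)
Definition recurse S l n (c : 'I_n -> var l n)
    (r : forall j : 'I_n, term S (var l j))
    (tau : var l n -> term S (var l n)) : var l n -> term S (var l n) :=
  foldl (fun tau j => [eta tau with c j |-> subst (tau \o @initial l n j) (r j)])
    tau (enum 'I_n).

(* [r j] has the variables x, y, z_1..z_l, x_1..x_j, y_1..y_j, hence arity
   2 * (j + 1) + l. *)
Definition sigma S l n zero (s : forall j : 'I_n, term S (var l j)) :=
  recurse vX s (start (Var vx) (Var vx) zero).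
Definition sigma_star S l n one (t : forall j : 'I_n, term S (var l j)) :=
  recurse vX t (start (Var vx) (Var vy) one).
Definition rho S l n zero (s : forall j : 'I_n, term S (var l j)) :=
  recurse vY s (start (Var vx) (Var vy) zero).
Definition rho_star S l n one (t : forall j : 'I_n, term S (var l j)) :=
  recurse vY t (start (Var vx) (Var vy) one).

(* Words over {1, .., N} are sequences over 'I_N, the letter j + 1 being
   represented by the ordinal j.  Families of terms indexed by words are total,
   but only words of length at most N matter below. *)

(* The links along the letters a + 1, .., b below the word w:
   L_w = L_(w (a+1)), R_(w j) = L_(w (j+1)) for a + 1 <= j <= b - 1,
   R_(w b) = R_w, all under tau. *)
Definition chain S (V : set (algebra S)) l n N
    (L R : seq 'I_N -> term S (var l n)) (tau : var l n -> term S (var l n))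
    (w : seq 'I_N) (a b : nat) :=
  [/\ forall i : 'I_N, i = a :> nat ->
        valid V (subst tau (L w)) (subst tau (L (rcons w i))),
      forall i j : 'I_N, a <= i -> j < b -> j = i.+1 :> nat ->
        valid V (subst tau (R (rcons w i))) (subst tau (L (rcons w j))) &
      forall i : 'I_N, i.+1 = b :> nat ->
        valid V (subst tau (R (rcons w i))) (subst tau (R w))].

Definition fixed_terms S (V : set (algebra S)) l
    (zero one : 'I_l -> term S void) k n
    (s t : forall j : 'I_n, term S (var l j))
    (L R : seq 'I_(2 * k) -> term S (var l n)) :=
  [/\ forall w, size w = 2 * k ->
        valid V (subst (rho zero s) (L w)) (subst (rho zero s) (R w)) /\
        valid V (subst (rho_star one t) (L w)) (subst (rho_star one t) (R w)),
      [/\ valid V (L [::]) (Var vx), valid V (R [::]) (Var vy) &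
          chain V L R (rho zero s) [::] 0 (2 * k)],
      forall w, 0 < size w < 2 * k -> ~~ odd (size w) ->
        chain V L R (rho zero s) w 0 k /\
        chain V L R (rho_star one t) w k (2 * k) &
      forall w, 0 < size w < 2 * k -> odd (size w) ->
        chain V L R (sigma zero s) w 0 k /\
        chain V L R (sigma_star one t) w k (2 * k)].

Inductive formula (S : signature) (X : Type) :=
| FEq of term S X & term S X
| FTop
| FAnd of formula S X & formula S X
| FImp of formula S X & formula S X
| FAll of X & formula S X
| FEx of X & formula S X.
Arguments FTop {S X}.

Fixpoint holds S (A : algebra S) (X : eqType) (v : X -> A) (p : formula S X) :
    Prop :=
  match p with
  | FEq s t => eval v s = eval v t
  | FTop => True
  | FAnd p q => holds v p /\ holds v q
  | FImp p q => holds v p -> holds v q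
  | FAll x p => forall a : A, holds [eta v with x |-> a] p
  | FEx x p => exists a : A, holds [eta v with x |-> a] p
  end.

Definition Psi S l n k (L R : seq 'I_(2 * k) -> term S (var l n)) (m : nat) :
    formula S (var l n) :=
  \big[@FAnd _ _/FTop]_(a : m.-tuple 'I_(2 * k))
    FImp (\big[@FAnd _ _/FTop]_(g : (2 * k).-bseq 'I_(2 * k)
                             | (0 < size g) && (size (a ++ g) <= 2 * k))
            FEq (L (a ++ g)) (R (a ++ g)))
         (FEq (L a) (R a)).

Definition Phi1 S l n k (L R : seq 'I_(2 * k) -> term S (var l n)) :
    formula S (var l n) :=
  foldr (fun j p => FEx (vY j) (FAll (vX j) p))
    (\big[@FAnd _ _/FTop]_(1 <= m < k.+1) Psi L R (2 * m)) (enum 'I_n).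

Definition Phi2 S l n k (L R : seq 'I_(2 * k) -> term S (var l n)) :
    formula S (var l n) :=
  foldr (fun j p => FEx (vX j) (FAll (vY j) p))
    (\big[@FAnd _ _/FTop]_(1 <= m < k.+1) Psi L R (2 * m - 1)) (enum 'I_n).

(* Assigns c, d, e to the free variables x, y, z of [Phi1] and [Phi2]; the
   value at the x_j and y_j, which are bound there, is irrelevant. *)
Definition assign S (A : algebra S) l n (c d : A) (e : 'I_l -> A)
    (v : var l n) : A :=
  match v with
  | vx => c
  | vy => d
  | vZ i => e i
  | vX _ | vY _ => c
  end.

(* Main.v *)
Require Import Defs.
From mathcomp Require Import all_boot.
From mathcomp Require Import all_classical.

(* If X is related to its image under a substitution by a congruence, an
   identity between substituted terms becomes a relation between the values of
   the original terms at X.  Choosing each y_j congruent to s_j modulo theta and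
   to t_j modulo theta* makes X congruent to rho(X) and rho*(X) respectively, so
   the identities along a word of even length give the formulas Psi of even
   index, whatever the x_j are: Phi1 always holds.  If c theta d, choosing the
   x_j in this way makes X congruent to sigma(X) and sigma*(X), and Phi2 holds.
   Conversely, playing the first strategy against Phi2 yields an X that
   satisfies all the Psi_m and is congruent to rho(X) modulo theta.  By downward
   induction on length, L and R agree at X on all nonempty words, and the
   identities at the empty word link c to d modulo theta. *)

Set Implicit Arguments.
Unset Strict Implicit.
Unset Printing Implicit Defensive.

Local Open Scope classical_set_scope.

(** * Terms under substitution and complementary congruences *)

Lemma eval_subst S (A : algebra S) X Y (v : Y -> A) (tau : X -> term S Y) p :
  eval v (subst tau p) = eval (fun x => eval v (tau x)) p.
Proof.
elim: p => [//|f u IH] /=; congr (interp A f _).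
by apply/funext => i; exact: IH.
Qed.

Lemma eval_closed_lift S (A : algebra S) Y (v : Y -> A) (p : term S void) :
  eval v (closed_lift Y p) = closed_val A p.
Proof.
by rewrite /closed_lift eval_subst /closed_val; congr eval; apply/funext; case.
Qed.

Lemma eval_congruence S (A : algebra S) (th : set (A * A)) X (v w : X -> A) p :
  congruence th -> (forall x, th (v x, w x)) -> th (eval v p, eval w p).
Proof.
move=> [_ _ _ thI] vw; elim: p => [x|f u IH] /=; first exact: vw.
by apply: thI => i; exact: IH.
Qed.

Lemma complementary_eq S (A : algebra S) (th ths : set (A * A)) x y :
  complementary th ths -> th (x, y) -> ths (x, y) -> x = y.
Proof.
move=> [_ _ dg _] h1 h2; have : (th `&` ths) (x, y) by [].
by rewrite dg.
Qed.

Lemma complementary_interpolate S (A : algebra S) (th ths : set (A * A)) x y :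
  complementary th ths -> exists z, th (x, z) /\ ths (y, z).
Proof.
move=> [_ [_ sy _ _] _ cp].
have : (ths \; th)%relation (x, y) by rewrite cp.
by case=> z /= h1 h2; exists z; split=> //; exact: sy.
Qed.

(** * Identities under a substitution, read modulo a congruence *)

Section Substitutions.
Variables (S : signature) (V : set (algebra S)) (A : algebra S) (hA : V A).
Variables (l n : nat).

Definition fixed_mod (th : set (A * A)) (v : var l n -> A)
    (tau : var l n -> term S (var l n)) :=
  forall u, th (eval v (tau u), v u).

Lemma valid_subst_mod th v tau p q : congruence th -> fixed_mod th v tau ->
  valid V (subst tau p) (subst tau q) -> th (eval v p, eval v q).
Proof.
move=> cg fx /(_ _ hA v); rewrite !eval_subst => pq.
have [_ sy tr _] := cg.
apply: tr (eval_congruence q cg fx).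
by rewrite -pq; apply: sy; exact: eval_congruence.
Qed.

(** Each link of the chain holds modulo [th] at [v], and the equality of [L] and [R] at the
    one-letter extensions joins each link to the next. *)
Lemma chain_mod N (L R : seq 'I_N -> term S (var l n)) th v tau w a b :
  congruence th -> fixed_mod th v tau -> a < b <= N -> chain V L R tau w a b ->
  (forall i, eval v (L (rcons w i)) = eval v (R (rcons w i))) ->
  th (eval v (L w), eval v (R w)).
Proof.
move=> cg fx /andP[ab bN] [first_link inner_link last_link] LR.
have [_ _ tr _] := cg.
have reach m : forall i : 'I_N, i = a + m :> nat -> i < b ->
    th (eval v (L w), eval v (R (rcons w i))).
  elim: m => [|m IH] i im ib.
    rewrite -(LR i); apply: (valid_subst_mod cg fx).
    by apply: first_link; rewrite im addn0.
  have jN : a + m < N by apply: ltn_trans (ltn_ord i); rewrite im addnS.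
  apply: (tr _ (eval v (R (rcons w (Ordinal jN))))).
    by apply: IH => //=; apply: ltn_trans ib; rewrite im addnS.
  rewrite -(LR i); apply: (valid_subst_mod cg fx); apply: inner_link => //=.
    by rewrite leq_addr.
  by rewrite im addnS.
have b0 : 0 < b by apply: leq_ltn_trans ab.
(* Letters start at 0, so the last one used is [b.-1]. *)
have jN : b.-1 < N by rewrite prednK.
apply: (tr _ (eval v (R (rcons w (Ordinal jN))))).
  have ab' : a <= b.-1 by rewrite -ltnS prednK.
  by apply: (reach (b.-1 - a)); rewrite /= ?subnKC // ltn_predL.
by apply: (valid_subst_mod cg fx); apply: last_link => /=; rewrite prednK.
Qed.

End Substitutions.

(** * Quantified variables and their order *)

(** The Boolean lets one lemma serve both quantifier patterns and both kinds of substitution. *)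
Definition vXY l n (b : bool) : 'I_n -> var l n := if b then vX else vY.

Definition bound l n (js : seq 'I_n) (u : var l n) : bool :=
  match u with
  | vX j | vY j => j \in js
  | _ => false
  end.

Lemma bound_vXY l n js b j : bound js (@vXY l n b j) = (j \in js).
Proof. by case: b. Qed.

Lemma bound_cons l n j js (u : var l n) :
  bound js u -> bound (j :: js) u.
Proof. by case: u => //= i; rewrite inE => ->; rewrite orbT. Qed.

(** Since the remaining indices increase, the arguments of the [j]-th term are already final when
    index [j] is reached. *)
Lemma initial_not_bound l n (j : 'I_n) js (u : var l j) :
  all (fun i : 'I_n => j < i) js -> ~~ bound (j :: js) (initial u).
Proof.
move=> /allP le_js.
have nin (i : 'I_j) : widen_ord (ltnW (ltn_ord j)) i \notin j :: js.
  rewrite inE -val_eqE /= ltn_eqF ?ltn_ord //=.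
  by apply/negP => /le_js /=; rewrite ltnNge (ltnW (ltn_ord i)).
by case: u => //= i; exact: nin.
Qed.

Lemma enum_pairwise n : pairwise (fun i j : 'I_n => i < j) (enum 'I_n).
Proof.
have <- := pairwise_map val ltn (enum 'I_n).
by rewrite val_enum_ord -(sorted_pairwise ltn_trans) iota_ltn_sorted.
Qed.

Lemma mem_enum_ord n (j : 'I_n) : j \in enum 'I_n.
Proof. by rewrite mem_enum. Qed.

(** * Valuations fixed by a recursive substitution *)

Section Recursion.
Variables (S : signature) (A : algebra S) (l n : nat).

(** Induction on the indices still to be processed; the invariant is that [tau] agrees with [v]
    modulo [th] outside the entries still to be replaced. The new entry at [j] reads only entries
    before it, where the invariant applies. *)
Lemma recurse_mod (th : set (A * A)) (v : var l n -> A) b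
    (r : forall j : 'I_n, term S (var l j)) tau :
  congruence th ->
  (forall u, (forall j, u <> vXY l b j) -> th (eval v (tau u), v u)) ->
  (forall j, th (eval (v \o @initial l n j) (r j), v (vXY l b j))) ->
  fixed_mod th v (recurse (vXY l b) r tau).
Proof.
move=> cg start_mod r_mod; rewrite /recurse.
have {start_mod} : forall u, (forall j, j \in enum 'I_n -> u <> vXY l b j) ->
    th (eval v (tau u), v u).
  by move=> u hu; apply: start_mod => j; apply: hu; rewrite mem_enum.
have [_ _ tr _] := cg.
elim: (enum 'I_n) (enum_pairwise n) tau => [_ tau tau_mod u|j js IH] /=.
  exact: tau_mod.
move=> /andP[lt_js js_lt] tau tau_mod; apply: IH => // u u_js /=.
case: eqP => [-> /=|u_j]; last first.
  by apply: tau_mod => i; rewrite inE => /orP[/eqP-> //|]; exact: u_js.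
rewrite eval_subst; apply: tr (r_mod j); apply: eval_congruence => // x.
apply: tau_mod => i i_js xi; have := initial_not_bound x lt_js.
by rewrite xi bound_vXY i_js.
Qed.

End Recursion.

(** * Strategies for alternating quantifiers *)

Section Games.
Variables (S : signature) (A : algebra S) (l n : nat).
Variable P : forall j : 'I_n, (var l j -> A) -> A -> Prop.
Hypothesis P_total : forall j f, exists z, @P j f z.

Definition agree js (w v : var l n -> A) := forall u, ~~ bound js u -> w u = v u.

Definition follows b (js : seq 'I_n) (w : var l n -> A) := forall j, j \in js ->
  P (w \o @initial l n j) (w (vXY l b j)).

Lemma agree_initial (j : 'I_n) js w v :
  all (fun i : 'I_n => j < i) js -> agree (j :: js) w v ->
  w \o @initial l n j = v \o @initial l n j.
Proof. by move=> lt_js wv; apply/funext => u; exact/wv/initial_not_bound. Qed.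

Lemma agree_cons b1 b2 (j : 'I_n) js (w v : var l n -> A) x y :
  agree js w [eta [eta v with vXY l b1 j |-> x] with vXY l b2 j |-> y] ->
  agree (j :: js) w v.
Proof.
move=> wv u uj.
rewrite wv /=; last by apply: contra uj; exact: bound_cons.
have nu b : u == vXY l b j = false.
  by apply/eqP => E; move: uj; rewrite E bound_vXY mem_head.
by rewrite !nu.
Qed.

Lemma vXY_negb b (j : 'I_n) : vXY l b j == vXY l (~~ b) j = false.
Proof. by apply/eqP; case: b. Qed.

Lemma not_in_tail (j : 'I_n) js :
  all (fun i : 'I_n => j < i) js -> j \notin js.
Proof. by move=> /allP lt_js; apply/negP => /lt_js; rewrite ltnn. Qed.

(** The witness of each block is a response to the earlier values. Later blocks leave these values
    unchanged, so it is still a response in the final valuation. *)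
Lemma win_exists_forall b (body : formula S (var l n)) js v :
  pairwise (fun i j : 'I_n => i < j) js ->
  (forall w, agree js w v -> follows b js w -> holds w body) ->
  holds v (foldr (fun j p => FEx (vXY l b j) (FAll (vXY l (~~ b) j) p)) body js).
Proof.
elim: js v => [v _ h|j js IH v] /=; first exact: h.
move=> /andP[lt_js js_lt] win.
have [y hy] := P_total (v \o @initial l n j).
exists y => x; apply: IH => // w wv fw; apply: win; first exact: agree_cons wv.
move=> i; rewrite inE => /orP[/eqP->|]; last exact: fw.
rewrite (agree_initial lt_js (agree_cons wv)) wv ?bound_vXY ?not_in_tail //=.
by rewrite vXY_negb eqxx.
Qed.

(** Here the responses instantiate the universal variables. They depend on earlier blocks only, so
    the witness [x] of the same block does not matter. *)
Lemma play_exists_forall b (body : formula S (var l n)) js v :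
  pairwise (fun i j : 'I_n => i < j) js ->
  holds v (foldr (fun j p => FEx (vXY l (~~ b) j) (FAll (vXY l b j) p)) body js) ->
  exists w, [/\ agree js w v, follows b js w & holds w body].
Proof.
elim: js v => [v _ h|j js IH v] /=; first by exists v.
move=> /andP[lt_js js_lt] [x].
have [y hy] := P_total (v \o @initial l n j).
move=> /(_ y) /(IH _ js_lt) [w [wv fw hw]]; exists w; split=> //.
  exact: agree_cons wv.
move=> i; rewrite inE => /orP[/eqP->|]; last exact: fw.
rewrite (agree_initial lt_js (agree_cons wv)) wv ?bound_vXY ?not_in_tail //=.
by rewrite eqxx.
Qed.

End Games.

(** * Semantics of the formulas Psi *)

Section Formulas.
Variables (S : signature) (A : algebra S).

Lemma holds_big_and (X I : eqType) (v : X -> A) (r : seq I) (P : pred I)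
    (F : I -> formula S X) :
  holds v (\big[@FAnd _ _/FTop]_(i <- r | P i) F i) <->
  forall i, i \in r -> P i -> holds v (F i).
Proof.
elim: r => [|i r IH]; first by rewrite big_nil.
rewrite big_cons; split=> [h j|h].
  rewrite inE => /orP[/eqP-> Pi|jr Pj]; first by move: h; rewrite Pi => -[].
  by apply: IH.1 => //; case: ifP h => // _ [].
have hr : holds v (\big[@FAnd _ _/FTop]_(j <- r | P j) F j).
  by apply/IH => j jr; apply: h; rewrite inE jr orbT.
by case: ifP => // Pi; split=> //; apply: h; rewrite ?mem_head.
Qed.

Lemma holds_Psi l n k (L R : seq 'I_(2 * k) -> term S (var l n)) m
    (v : var l n -> A) :
  holds v (Psi L R m) <->
  forall w, size w = m ->
    (forall g, 0 < size g -> size (w ++ g) <= 2 * k ->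
       eval v (L (w ++ g)) = eval v (R (w ++ g))) ->
    eval v (L w) = eval v (R w).
Proof.
rewrite /Psi; split=> [/holds_big_and h w wm LR|h].
  have /= := h (tcast wm (in_tuple w)) (mem_index_enum _) isT.
  rewrite val_tcast; apply; apply/holds_big_and => g _ /andP[]; exact: LR.
apply/holds_big_and => w _ _ /= /holds_big_and LR.
apply: h; first exact: size_tuple.
(* The bound on [w ++ g] also bounds [g], so indexing by bounded sequences misses no extension. *)
move=> g g0 gN; have gN' : size g <= 2 * k.
  by apply: leq_trans gN; rewrite size_cat leq_addl.
by apply: (LR (Bseq gN') (mem_index_enum _)); rewrite /= g0.
Qed.

End Formulas.

(** The first [k] letters link [L w] to [R w] modulo [th], the last [k] modulo [ths]; the two
    congruences meet in the diagonal. *)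
Lemma holds_Psi_chain S (V : set (algebra S)) (A : algebra S) l n k
    (L R : seq 'I_(2 * k) -> term S (var l n)) (th ths : set (A * A)) v tau taus
    m :
  V A -> complementary th ths -> 0 < k -> m < 2 * k ->
  fixed_mod th v tau -> fixed_mod ths v taus ->
  (forall w, size w = m ->
     chain V L R tau w 0 k /\ chain V L R taus w k (2 * k)) ->
  holds v (Psi L R m).
Proof.
move=> hA hth hk mN fx fxs ch; apply/holds_Psi => w wm LR.
have [cg cgs _ _] := hth; have [c1 c2] := ch w wm.
have LR1 i : eval v (L (rcons w i)) = eval v (R (rcons w i)).
  by rewrite -cats1; apply: LR; rewrite // size_cat wm addn1.
apply: (complementary_eq hth).
  by apply: (chain_mod hA cg fx _ c1 LR1); rewrite hk mul2n -addnn leq_addr.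
by apply: (chain_mod hA cgs fxs _ c2 LR1); rewrite leqnn andbT ltn_Pmull.
Qed.

(** * The responses and the formulas Phi *)

Section Response.
Variables (S : signature) (V : set (algebra S)) (l : nat).
Variables (zero one : 'I_l -> term S void) (k n : nat) (hk : 0 < k).
Variables (s t : forall j : 'I_n, term S (var l j)).
Variables (L R : seq 'I_(2 * k) -> term S (var l n)).
Hypothesis hterms : fixed_terms V zero one s t L R.
Variables (A : algebra S) (hA : V A) (th ths : set (A * A)).
Hypothesis hth : complementary th ths.
Variables (e : 'I_l -> A) (he : separates zero one th ths e) (c d : A).

(** Used for y_j it fixes [rho] and [rho_star], used for x_j [sigma] and [sigma_star]. *)
Definition response (j : 'I_n) (f : var l j -> A) (z : A) :=
  th (eval f (s j), z) /\ ths (eval f (t j), z).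

Lemma response_total j f : exists z, @response j f z.
Proof. exact: complementary_interpolate. Qed.

Let v0 : var l n -> A := assign c d e.

Lemma start_mod (cg : set (A * A)) b x' y' z' v :
  congruence cg -> agree (enum 'I_n) v v0 ->
  cg (eval v x', c) -> cg (eval v y', d) ->
  (forall i, cg (closed_val A (z' i), e i)) ->
  forall (r : forall j : 'I_n, term S (var l j)),
  (forall j, cg (eval (v \o @initial l n j) (r j), v (vXY l b j))) ->
  fixed_mod cg v (recurse (vXY l b) r (start x' y' z')).
Proof.
move=> hcg vv0 hx hy hz r hr; have [rf _ _ _] := hcg.
apply: recurse_mod => // u _.
by case: u => [| |i|j|j] /=; rewrite ?eval_closed_lift // vv0.
Qed.

Section Even.
Variable v : var l n -> A.
Hypotheses (vv0 : agree (enum 'I_n) v v0)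
  (fv : follows response false (enum 'I_n) v).

Lemma fixed_mod_rho : fixed_mod th v (rho zero s).
Proof.
have [cg _ _ _] := hth; have [rf _ _ _] := cg.
apply: (start_mod (b := false)) => //= [||i|j].
- by rewrite vv0.
- by rewrite vv0.
- by case: (he i).
- by case: (fv (mem_enum_ord j)).
Qed.

Lemma fixed_mod_rho_star : fixed_mod ths v (rho_star one t).
Proof.
have [_ cg _ _] := hth; have [rf sy _ _] := cg.
apply: (start_mod (b := false)) => //= [||i|j].
- by rewrite vv0.
- by rewrite vv0.
- by apply: sy; case: (he i).
- by case: (fv (mem_enum_ord j)).
Qed.

Lemma Psi_even m : 0 < m <= 2 * k -> ~~ odd m -> holds v (Psi L R m).
Proof.
have [top _ even _] := hterms; have [cg cgs _ _] := hth.
(* At length [2 * k] there are no longer words, and the identities relate [L w] and [R w]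
   directly. *)
move=> /andP[m0]; rewrite leq_eqVlt => /orP[/eqP-> _|mN m_even].
  apply/holds_Psi => w wN _; have [h1 h2] := top w wN.
  apply: (complementary_eq hth).
    exact: (valid_subst_mod hA cg fixed_mod_rho).
  exact: (valid_subst_mod hA cgs fixed_mod_rho_star).
apply: (holds_Psi_chain hA hth hk mN fixed_mod_rho fixed_mod_rho_star) => w wm.
by apply: even; rewrite wm // m0.
Qed.

End Even.

Lemma Psi_odd v m : th (c, d) -> agree (enum 'I_n) v v0 ->
  follows response true (enum 'I_n) v -> m < 2 * k -> odd m ->
  holds v (Psi L R m).
Proof.
move=> cd vv0 fv mN m_odd; have [_ _ _ odd_chain] := hterms.
have [cg cgs _ _] := hth; have [rfs sys _ _] := cgs; have [rf _ _ _] := cg.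
apply: (holds_Psi_chain (tau := sigma zero s) (taus := sigma_star one t)
  hA hth hk mN) => [||w wm].
- apply: (start_mod (b := true)) => //= [||i|j].
  + by rewrite vv0.
  (* As [sigma] puts x in place of y, this is where [th (c, d)] enters. *)
  + by rewrite vv0.
  + by case: (he i).
  + by case: (fv j (mem_enum_ord j)).
- apply: (start_mod (b := true)) => //= [||i|j].
  + by rewrite vv0.
  + by rewrite vv0.
  + by apply: sys; case: (he i).
  + by case: (fv j (mem_enum_ord j)).
- by apply: odd_chain; rewrite wm // mN andbT odd_gt0.
Qed.

Lemma holds_Phi1 : holds v0 (Phi1 L R).
Proof.
apply: (win_exists_forall response_total (b := false) (enum_pairwise n)).
move=> v vv0 fv; apply/holds_big_and => m; rewrite mem_index_iota ltnS.
move=> /andP[m0 mk] _.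
by apply: Psi_even; rewrite ?muln_gt0 ?m0 ?leq_mul2l //= oddM.
Qed.

Lemma holds_Phi2 : th (c, d) -> holds v0 (Phi2 L R).
Proof.
move=> cd.
apply: (win_exists_forall response_total (b := true) (enum_pairwise n)).
move=> v vv0 fv; apply/holds_big_and => m; rewrite mem_index_iota ltnS.
move=> /andP[m0 mk] _.
have m2 : 0 < 2 * m by rewrite muln_gt0.
apply: Psi_odd => //; first by rewrite subn1 prednK // leq_mul2l.
by rewrite oddB // oddM.
Qed.

Lemma Phi2_mod : holds v0 (Phi2 L R) -> th (c, d).
Proof.
move=> /(play_exists_forall response_total (b := false) (enum_pairwise n)).
move=> [v [vv0 fv /holds_big_and psi]].
(* Even indices hold because [v] follows the responses for the y_j, odd ones because they form the
   body of [Phi2]. *)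
have all_psi m : 0 < m <= 2 * k -> holds v (Psi L R m).
  move=> mN; have [m_odd|m_even] := boolP (odd m); last exact: Psi_even.
  move: mN; rewrite -(odd_double_half m) m_odd add1n => /= mN.
  have -> : (m./2).*2.+1 = 2 * (m./2).+1 - 1 by rewrite mul2n.
  apply: psi; rewrite // mem_index_iota /= ltnS.
  by rewrite -ltn_double -(mul2n k).
have LR w : 0 < size w <= 2 * k -> eval v (L w) = eval v (R w).
  have [q] := ubnP (2 * k - size w); elim: q w => // q IH w wq wN.
  have /holds_Psi := all_psi _ wN; apply=> // g g0 gN.
  have [w0 _] := andP wN; apply: IH; last by rewrite gN size_cat addn_gt0 w0.
  have wg : size w < size (w ++ g) by rewrite size_cat -[ltnLHS]addn0 ltn_add2l.
  rewrite -ltnS; apply: leq_trans wq.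
  by rewrite ltnS ltn_sub2l // (leq_trans wg).
have [_ [Le Re ch] _ _] := hterms; have [cg _ _ _] := hth.
(* At the empty word a single chain under [rho] uses all [2 * k] letters, so the conclusion is
   modulo [th] alone. *)
have := chain_mod hA cg (fixed_mod_rho vv0 fv) _ ch.
rewrite Le // Re //= !vv0 //; apply; first by rewrite muln_gt0 hk leqnn.
by move=> i; apply: LR; rewrite /= muln_gt0.
Qed.

End Response.

Theorem theorem8 (S : signature) (V : set (algebra S)) (l : nat)
    (zero one : 'I_l -> term S void)
    (hV : variety01 V zero one)
    (hDP : determining_property V zero one)
    (k n : nat) (hk : 0 < k) (hn : 0 < n)
    (s t : forall j : 'I_n, term S (var l j))
    (L R : seq 'I_(2 * k) -> term S (var l n))
    (hterms : fixed_terms V zero one s t L R)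
    (A : algebra S) (hA : V A)
    (th ths : set (A * A)) (hth : complementary th ths)
    (e : 'I_l -> A) (he : separates zero one th ths e) (c d : A) :
  th (c, d) <-> holds (assign c d e) (FAnd (Phi1 L R) (Phi2 L R)).
Proof.
split=> [cd|[_]]; last exact: (Phi2_mod hk hterms hA hth he).
split; first exact: (holds_Phi1 hk hterms hA hth he).
exact: (holds_Phi2 hk hterms hA hth he).
Qed.
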